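(* Let $G$ be a connected graph, let $x,y$ be two distinct vertices of $G$, let $n\ge 3$, and let $F_n(G)=F_n(G,x,y)$ be the generalized flower graph with petals $G_1,\dots,G_n$ (cyclically arranged copies of $G$, the vertex $y$ of $G_i$ being identified with the vertex $x$ of $G_{i+1}$, indices mod $n$). Let $u,v$ be vertices of $F_n(G)$. (i) Suppose $u$ and $v$ are in different copies of $G$. Label the copies cyclically such that $u\in V(G_1)$ and $v\in V(G_d)$, $2\le d\le n$ (so $d$ is the number of copies of $G$ between $u$ and $v$, inclusive). Then $$r_{F_n(G)}(u,v) = r_G(u,y) + r_G(v,x) +(d-2)\,r_G(x,y) - \frac{\left[r_G(u,x)+r_G(v,y)-r_G(u,y)-r_G(v,x)-2(d-1)\,r_G(x,y)\right]^2}{4n\,r_G(x,y)} .$$ (ii) If $u,v$ are both in the same copy of $G$, then $$r_{F_n(G)}(u,v) = r_G(u,v) - \frac{\left[r_G(u,x)+r_G(v,y)-r_G(u,y)-r_G(v,x)\right]^2}{4n\,r_G(x,y)} .$$ On the right-hand sides, $u$ and $v$ denote the vertices of $G$ corresponding to $u$ and $v$ in the copies of $G$ that contain them.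
   Context: For a connected graph $H$ with vertex set $\{1,\dots,N\}$ and Laplacian matrix $L$, the resistance distance (effective resistance) between vertices $i,j$ is $r_H(i,j)=(e_i-e_j)^T L^\dagger (e_i-e_j)$, where $e_i$ is the $i$th standard unit vector and $L^\dagger$ is the Moore–Penrose pseudoinverse of $L$. Generalized flower graph: let $G$ be a graph, $x\ne y$ two vertices of $G$, and $n\ge 3$. $F_n(G,x,y)$ (written $F_n(G)$) is the graph obtained by taking $n$ vertex-disjoint copies $G_1,\dots,G_n$ of $G$ (the petals), with $x_i,y_i$ the copies of $x,y$ in $G_i$, and identifying $y_i$ with $x_{i+1}$ for $1\le i<n$ and $y_n$ with $x_1$. The vertices $x_1,\dots,x_n$ of $F_n(G)$ are called the associated vertices; each lies in two consecutive petals. *)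

(* Defs.v *)
From HB Require Import structures.
From mathcomp Require Import all_boot all_order all_algebra.
From mathcomp Require Import generic_quotient.

Set Implicit Arguments.
Unset Strict Implicit.
Unset Printing Implicit Defensive.

Import Order.TTheory GRing.Theory Num.Theory.
Local Open Scope ring_scope.
Local Open Scope quotient_scope.

Section MoorePenrose.
Variable R : realFieldType.

(* The four Penrose conditions (real case: the adjoint is the transpose). *)
Definition is_mpinv m n (A : 'M[R]_(m, n)) (X : 'M[R]_(n, m)) : bool :=
  [&& A *m X *m A == A, X *m A *m X == X,
      (A *m X)^T == A *m X & (X *m A)^T == X *m A].

Lemma mulmx_tr_eq0 m n (A : 'M[R]_(m, n)) : A *m A^T = 0 -> A = 0.
Proof.
move=> A0; apply/matrixP => i j; have /matrixP/(_ i i) := A0.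
rewrite !mxE => /eqP; rewrite psumr_eq0; last first.
  by move=> k _; rewrite !mxE -expr2 sqr_ge0.
by move=> /allP/(_ j (mem_index_enum _)); rewrite !mxE mulf_eq0 orbb => /eqP.
Qed.

Lemma row_free_gram m n (A : 'M[R]_(m, n)) :
  row_free A -> A *m A^T \in unitmx.
Proof.
move=> fA; rewrite -row_free_unit; apply: inj_row_free => v vA0.
apply: (row_free_inj fA); rewrite mul0mx; apply: mulmx_tr_eq0.
by rewrite trmx_mul !mulmxA -(mulmxA v) vA0 mul0mx.
Qed.

Lemma mpinv_factor m n k (C : 'M[R]_(m, k)) (B : 'M[R]_(k, n)) :
  row_full C -> row_free B -> exists X, is_mpinv (C *m B) X.
Proof.
move=> fC fB; have uB : B *m B^T \in unitmx by exact: row_free_gram.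
have uC : C^T *m C \in unitmx.
  rewrite -{2}[C]trmxK; apply: row_free_gram.
  by rewrite /row_free mxrank_tr.
pose P := B^T *m invmx (B *m B^T); pose Q := invmx (C^T *m C) *m C^T.
have BP : B *m P = 1%:M by rewrite /P mulmxA mulmxV.
have QC : Q *m C = 1%:M by rewrite /Q -mulmxA mulVmx.
have AX : C *m B *m (P *m Q) = C *m Q.
  by rewrite mulmxA -(mulmxA C) BP mulmx1.
have XA : P *m Q *m (C *m B) = P *m B.
  by rewrite mulmxA -(mulmxA P) QC mulmx1.
exists (P *m Q); apply/and4P; split; apply/eqP.
- by rewrite AX mulmxA -(mulmxA C) QC mulmx1.
- by rewrite XA mulmxA -(mulmxA P) BP mulmx1.
- by rewrite AX /Q !trmx_mul trmx_inv trmx_mul !trmxK mulmxA.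
- by rewrite XA /P !trmx_mul trmx_inv trmx_mul !trmxK mulmxA.
Qed.

Lemma mpinv_exists m n (A : 'M[R]_(m, n)) : exists X, is_mpinv A X.
Proof.
have [X] := mpinv_factor (col_base_full A) (row_base_free A).
by rewrite mulmx_base; exists X.
Qed.

Lemma is_mpinv_uniq m n (A : 'M[R]_(m, n)) X Y :
  is_mpinv A X -> is_mpinv A Y -> X = Y.
Proof.
case/and4P=> /eqP X1 /eqP X2 /eqP X3 /eqP X4.
case/and4P=> /eqP Y1 /eqP Y2 /eqP Y3 /eqP Y4.
have AXY : A *m X = A *m Y.
  rewrite -X3 -{1}Y1 -(mulmxA (A *m Y)) trmx_mul X3 Y3.
  by rewrite mulmxA X1.
have XYA : X *m A = Y *m A.
  rewrite -X4 -{1}Y1 !mulmxA -(mulmxA (X *m A)) trmx_mul X4 Y4.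
  by rewrite -mulmxA (mulmxA A) X1.
by rewrite -X2 XYA -mulmxA AXY mulmxA Y2.
Qed.

Definition mpinv m n (A : 'M[R]_(m, n)) : 'M[R]_(n, m) :=
  xchoose (mpinv_exists A).

Lemma mpinvP m n (A : 'M[R]_(m, n)) : is_mpinv A (mpinv A).
Proof. exact: xchooseP. Qed.

End MoorePenrose.

(* A graph is a symmetric irreflexive relation e on a finite type T; its
   vertices are numbered by enum_rank, and the value of resistance does not
   depend on the numbering. *)
Section Resistance.
Variables (R : realFieldType) (T : finType) (e : rel T).

Definition laplacian : 'M[R]_#|T| :=
  \matrix_(i, j)
    if i == j then #|[set w | e (enum_val i) w]|%:R
    else - (e (enum_val i) (enum_val j))%:R.

Definition unit_vec (u : T) : 'cV[R]_#|T| := delta_mx (enum_rank u) 0.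

Definition resistance (u v : T) : R :=
  ((unit_vec u - unit_vec v)^T *m mpinv laplacian
     *m (unit_vec u - unit_vec v)) 0 0.

End Resistance.

Section Flower.
Variables (T : finType) (e : rel T) (n : nat) (x y : T).

(* (i, a) stands for the copy of the vertex a in the i-th petal; ordS is the
   cyclic successor on 'I_n. *)
Definition glue : rel ('I_n * T) :=
  [rel p q | [&& p.2 == y, q.2 == x & q.1 == ordS p.1]].

(* The equivalence relation generated by glue. *)
Definition glued : rel ('I_n * T) := connect (relU glue (fun p q => glue q p)).

Lemma glued_refl : reflexive glued.
Proof. exact: connect0. Qed.

Lemma glued_sym : symmetric glued.
Proof. by apply: sym_connect_sym => p q /=; rewrite orbC. Qed.

Lemma glued_trans : transitive glued.
Proof. exact: connect_trans. Qed.

Canonical glued_equiv := EquivRel glued glued_refl glued_sym glued_trans.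

Definition flower := {eq_quot glued_equiv}.

HB.instance Definition _ := EqQuotient.on flower.
HB.instance Definition _ := Choice.on flower.
HB.instance Definition _ := Countable.copy flower
  (can_type (@reprK ('I_n * T)%type flower)).
HB.instance Definition _ : isFinite flower :=
  CanIsFinite (@reprK ('I_n * T)%type flower).

Definition petal (i : 'I_n) (a : T) : flower := \pi_flower (i, a).

Definition flower_adj : rel flower :=
  [rel u v | [exists i, exists a, exists b,
     [&& e a b, petal i a == u & petal i b == v]]].

Lemma petal_surj (u : flower) : exists i a, u = petal i a.
Proof. by exists (repr u).1, (repr u).2; rewrite /petal -surjective_pairing reprK. Qed.

Lemma petal_glue (i : 'I_n) : petal i y = petal (ordS i) x.
Proof. by apply/eqP; rewrite eqmodE; apply: connect1; rewrite /= /glue /= !eqxx. Qed.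

Lemma petal_eq (i j : 'I_n) (a b : T) : x != y ->
  (petal i a == petal j b) =
  ((if a == y then (ordS i, x) else (i, a)) ==
   (if b == y then (ordS j, x) else (j, b))).
Proof.
move=> xy; pose c (p : 'I_n * T) := if p.2 == y then (ordS p.1, x) else p.
have pc p : petal p.1 p.2 = petal (c p).1 (c p).2.
  by rewrite /c; case: eqP => [->|//]; exact: petal_glue.
rewrite -[LHS]/(petal (i, a).1 (i, a).2 == petal (j, b).1 (j, b).2).
apply/eqP/eqP; last first.
  by rewrite pc (pc (j, b)) -/(c (i, a)) -/(c (j, b)) => ->.
have cg p q : glue p q -> c p = c q.
  case: p q => [k s] [l t] /and3P[/= /eqP-> /eqP-> /eqP->].
  by rewrite /c /= eqxx (negPf xy).
suff h p q : glued p q -> c p = c q by move=> /eqmodP; apply: h.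
case/connectP=> s; elim: s p => [|t s IHs] p /=; first by move=> _ ->.
by case/andP=> /orP[] /cg pt ps /(IHs _ ps) <-.
Qed.

Lemma flower_adj_sym : symmetric e -> symmetric flower_adj.
Proof.
move=> se; suff h u v : flower_adj u v -> flower_adj v u.
  by move=> u v; apply/idP/idP; apply: h.
case/existsP=> i; case/existsP=> a; case/existsP=> b; case/and3P=> ab au bv.
apply/existsP; exists i; apply/existsP; exists b; apply/existsP; exists a.
by rewrite se ab au bv.
Qed.

Lemma flower_adj_irr :
  irreflexive e -> x != y -> (1 < n)%N -> irreflexive flower_adj.
Proof.
move=> ie xy n1 u; apply/negbTE/negP; rewrite /flower_adj /= => uu.
case/existsP: uu => i.
case/existsP=> a; case/existsP=> b; case/and3P=> ab /eqP <-; rewrite petal_eq //.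
have Si : (ordS i == i) = false.
  apply/negP=> /eqP/(congr1 val) /= h.
  have := ltn_ord i; rewrite leq_eqVlt => /orP[/eqP E|lt]; last first.
    by move: h; rewrite modn_small // => /eqP; rewrite eqn_leq ltnn.
  by move: h; rewrite E modnn => h; move: n1; rewrite -E -h.
case: (a =P y) => [Ea|_]; case: (b =P y) => [Eb|_];
  rewrite xpair_eqE ?(eq_sym i) ?Si ?eqxx //=.
- by move: ab; rewrite Ea Eb ie.
- by move/eqP=> Eb; move: ab; rewrite Eb ie.
Qed.

End Flower.

(* Main.v *)
(* If L f = e_u - e_v, then r(u,v) = f u - f v, whatever the choice of the
   potential f. A unit current from u to v in the flower is obtained by letting
   it run through the consecutive petals from the one of u to the one of v, each
   carrying a potential of G that is a unit flow between the two vertices where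
   the path enters and leaves it. These potentials agree at the associated
   vertices once a circulation c (a flow of value c from x to y in every petal)
   is added, with c such that the total potential drop D + n c r_G(x,y) around
   the cycle is 0. By reciprocity the circulation lowers the resistance of the
   path of petals by D^2 / (n r_G(x,y)). *)
Require Import Defs.
From mathcomp Require Import all_boot all_order all_algebra.
From mathcomp Require Import generic_quotient ring.

Set Implicit Arguments.
Unset Strict Implicit.
Unset Printing Implicit Defensive.

Import Order.TTheory GRing.Theory Num.Theory.
Local Open Scope ring_scope.

(** * Potentials, energy and Green function of a finite graph *)

Lemma sum_delta_diff (R : pzRingType) (T : finType) (f : T -> R) (u v : T) :
  \sum_s f s * ((s == u)%:R - (s == v)%:R) = f u - f v.
Proof.
have sum1 p : \sum_s f s * (s == p)%:R = f p.
  rewrite (bigD1 p) //= eqxx mulr1 big1 ?addr0 // => s /negPf->.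
  by rewrite mulr0.
under eq_bigr do rewrite mulrBr.
by rewrite sumrB !sum1.
Qed.

Lemma is_mpinv_tr (R : realFieldType) m n (A : 'M[R]_(m, n)) X :
  is_mpinv A X -> is_mpinv A^T X^T.
Proof.
case/and4P=> /eqP AXA /eqP XAX /eqP AX /eqP XA.
by apply/and4P; split; rewrite -?mulmxA -!trmx_mul ?mulmxA ?AXA ?XAX ?AX ?XA.
Qed.

Section Potentials.
Variables (R : realFieldType) (T : finType) (e : rel T).
Hypothesis e_sym : symmetric e.

Definition lap (f : T -> R) (s : T) : R := \sum_(t | e s t) (f s - f t).

Definition vec_of (f : T -> R) : 'cV[R]_#|T| := \col_i f (enum_val i).

Lemma unit_vecE u : unit_vec R u = vec_of (fun s => (s == u)%:R).
Proof.
apply/matrixP => i j; rewrite !mxE ord1 eqxx andbT.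
by rewrite -(inj_eq enum_rank_inj) enum_valK.
Qed.

Lemma vec_ofB f g : vec_of (fun s => f s - g s) = vec_of f - vec_of g.
Proof. by apply/matrixP => i j; rewrite !mxE. Qed.

Lemma dot_vec_of f g : ((vec_of f)^T *m vec_of g) 0 0 = \sum_s f s * g s.
Proof.
rewrite mxE (reindex (@enum_val T T)) /=; last by apply: onW_bij; exact: enum_val_bij.
by apply: eq_bigr => i _; rewrite !mxE.
Qed.

Hypothesis e_irr : irreflexive e.

Lemma laplacian_vec_of f : laplacian R e *m vec_of f = vec_of (lap f).
Proof.
apply/matrixP => i j; rewrite !mxE /lap sumrB sumr_const.
rewrite (bigD1 i) //= !mxE eqxx -[f _ *+ _]mulr_natl; congr (_ * _ + _).
  by congr (_%:R); apply: eq_card => s; rewrite inE.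
rewrite [in RHS]big_mkcond (reindex (@enum_val T T)) /=; last first.
  by apply: onW_bij; exact: enum_val_bij.
rewrite [in RHS](bigD1 i) //= e_irr add0r -sumrN; apply: eq_bigr => k ki.
rewrite !mxE eq_sym (negPf ki) mulNr.
by case: (e _ _); rewrite ?mul1r ?mul0r.
Qed.

Lemma laplacian_tr : (laplacian R e)^T = laplacian R e.
Proof.
apply/matrixP => i j; rewrite !mxE eq_sym e_sym.
by case: eqP => [->|].
Qed.

(** As [L] is symmetric and [L X L = L], the quadratic form of the pseudoinverse at [L f] reduces to
    that of [L] at [f]. *)
Lemma resistance_potential f u v :
  (forall s, lap f s = (s == u)%:R - (s == v)%:R) ->
  resistance R e u v = f u - f v.
Proof.
move=> fuv; rewrite /resistance.
have Lf : unit_vec R u - unit_vec R v = laplacian R e *m vec_of f.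
  by rewrite laplacian_vec_of !unit_vecE -vec_ofB; apply/matrixP=> i j; rewrite !mxE fuv.
rewrite Lf trmx_mul laplacian_tr.
case/and4P: (mpinvP (laplacian R e)) => /eqP LXL _ _ _.
rewrite -!mulmxA (mulmxA (laplacian R e)) (mulmxA (_ *m _)) LXL laplacian_vec_of dot_vec_of.
by under eq_bigr do rewrite fuv; exact: sum_delta_diff.
Qed.

(** Summation by parts; the factor 2 appears because each edge is counted in both orientations. *)
Lemma energy f : 2 * \sum_s f s * lap f s = \sum_s \sum_(t | e s t) (f s - f t) ^+ 2.
Proof.
have E1 : \sum_s f s * lap f s = \sum_s \sum_(t | e s t) f s * (f s - f t).
  by apply: eq_bigr => s _; rewrite mulr_sumr.
have E2 : \sum_s f s * lap f s = \sum_s \sum_(t | e s t) - f t * (f s - f t).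
  rewrite E1 (exchange_big_dep xpredT) //=; apply: eq_bigr => s _.
  by apply: eq_big => [t|t _]; rewrite 1?e_sym //; ring.
rewrite mulr_natl mulr2n {1}E1 E2 -big_split /=; apply: eq_bigr => s _.
by rewrite -big_split /=; apply: eq_bigr => t _; ring.
Qed.

Hypothesis e_conn : forall s t, connect e s t.

Lemma energy_eq0 f : \sum_s f s * lap f s = 0 -> forall s t, f s = f t.
Proof.
move=> f0 s t; have := energy f; rewrite f0 mulr0 => /esym/eqP.
have ge0 p : 0 <= \sum_(q | e p q) (f p - f q) ^+ 2.
  by apply: sumr_ge0 => q _; exact: sqr_ge0.
rewrite psumr_eq0; last by move=> p _; exact: ge0.
move=> /allP H.
have fe p q : e p q -> f p = f q.
  move=> pq; have /implyP/(_ isT) := H p (mem_index_enum _).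
  rewrite psumr_eq0; last by move=> k _; exact: sqr_ge0.
  by move=> /allP/(_ q (mem_index_enum _)); rewrite pq /= sqrf_eq0 subr_eq0 => /eqP.
case/connectP: (e_conn s t) => p.
by elim: p s => [|q p IHp] s /= => [_ ->|/andP[/fe -> /IHp]] //; apply.
Qed.

(** A difference of two columns is the potential of a unit flow, by [lap_green]. *)
Definition green (s t : T) : R := mpinv (laplacian R e) (enum_rank s) (enum_rank t).

Lemma green_sym s t : green s t = green t s.
Proof.
have := is_mpinv_tr (mpinvP (laplacian R e)); rewrite laplacian_tr => XT.
by rewrite /green -{1}(is_mpinv_uniq XT (mpinvP _)) mxE.
Qed.

Lemma vec_of_green s t :
  mpinv (laplacian R e) *m (unit_vec R s - unit_vec R t)
  = vec_of (fun p => green p s - green p t).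
Proof.
by apply/matrixP => i j; rewrite mulmxBr -!colE !mxE /green enum_valK.
Qed.

Lemma resistance_green s t :
  resistance R e s t = green s s - green s t - (green t s - green t t).
Proof.
rewrite /resistance -mulmxA vec_of_green !unit_vecE -vec_ofB dot_vec_of.
by under eq_bigr do rewrite mulrC; rewrite sum_delta_diff.
Qed.

Lemma lap_green s t p :
  lap (fun q => green q s - green q t) p = (p == s)%:R - (p == t)%:R.
Proof.
(* The defect z = (1 - L X) (e_s - e_t) is harmonic, hence constant, and
   z^T z = z^T (e_s - e_t) = z s - z t = 0. *)
set L := laplacian R e; set w := unit_vec R s - unit_vec R t.
case/and4P: (mpinvP L) => /eqP H1 _ /eqP H3 _.
have LT : L^T = L := laplacian_tr.
have LLX : L *m (L *m mpinv L) = L.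
  by rewrite -{1}LT -H3 -trmx_mul H1 LT.
pose z q := (q == s)%:R - (q == t)%:R - lap (fun q => green q s - green q t) q.
have zE : vec_of z = w - L *m (mpinv L *m w).
  by rewrite vec_of_green laplacian_vec_of /w !unit_vecE -!vec_ofB.
have Lz : L *m vec_of z = 0 by rewrite zE mulmxBr !mulmxA -[L *m L *m _]mulmxA LLX subrr.
have zc : forall q q', z q = z q'.
  apply: energy_eq0; rewrite -dot_vec_of -laplacian_vec_of Lz mulmx0 mxE //.
have zz : (vec_of z)^T *m (vec_of z)^T^T = 0.
  have zL : (vec_of z)^T *m L = 0 by rewrite -LT -trmx_mul Lz trmx0.
  rewrite trmxK {2}zE mulmxBr (mulmxA _ L) zL mul0mx subr0.
  apply/matrixP => i j; rewrite !ord1 /w !unit_vecE -vec_ofB dot_vec_of mxE.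
  by rewrite sum_delta_diff (zc s t) subrr.
have /matrixP/(_ 0 (enum_rank p)) := mulmx_tr_eq0 zz.
by rewrite !mxE enum_rankK => /eqP; rewrite subr_eq0 => /eqP.
Qed.

(** Zero resistance would give the unit flow potential zero energy, making it constant, against the
    unit source at [s]. *)
Lemma resistance_neq0 s t : s != t -> resistance R e s t != 0.
Proof.
move=> st; apply/eqP => r0.
pose h q := green q s - green q t.
have hE : forall q, lap h q = (q == s)%:R - (q == t)%:R by exact: lap_green.
have hc : forall q q', h q = h q'.
  apply: energy_eq0; under eq_bigr do rewrite hE.
  by rewrite sum_delta_diff -r0 resistance_green.
have := hE s; rewrite eqxx (negPf st) subr0 /lap big1 => [/eqP|q _]; last first.
  by rewrite (hc s q) subrr.
by rewrite eq_sym oner_eq0.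
Qed.

End Potentials.

(** * Petals: edges, Laplacian and potentials of the flower *)

Lemma val_iter_ordS n (i : 'I_n) k : val (iter k (@ordS n) i) = ((i + k) %% n)%N.
Proof.
elim: k => [|k IHk] /=; first by rewrite addn0 modn_small.
by rewrite IHk -addn1 modnDml addn1 addnS.
Qed.

Lemma eq_iter_ordS n (i : 'I_n) k l : (k < n)%N -> (l < n)%N ->
  (iter k (@ordS n) i == iter l (@ordS n) i) = (k == l).
Proof.
by move=> kn ln; rewrite -val_eqE !val_iter_ordS eqn_modDl !modn_small.
Qed.

Section Petals.
Variables (R : realFieldType) (T : finType) (n : nat) (x y : T).
Hypothesis xy : x != y.

Lemma petal_inj (i : 'I_n) : (1 < n)%N -> injective (petal x y i).
Proof.
move=> n1 a b /eqP; rewrite petal_eq //.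
have := eq_iter_ordS i n1 (ltnW n1) => /= Si.
by case: (a =P y) => [->|_]; case: (b =P y) => [->|_];
  rewrite xpair_eqE //= ?(eq_sym i) ?Si //; case/andP=> _ /eqP.
Qed.

(* For n = 2 this fails when x and y are adjacent. *)
Lemma petal_edge_inj (e : rel T) (i j : 'I_n) (a b a' b' : T) :
  irreflexive e -> (3 <= n)%N -> e a b -> e a' b' ->
  petal x y i a = petal x y j a' -> petal x y i b = petal x y j b' ->
  [/\ i = j, a = a' & b = b'].
Proof.
move=> e_irr n3 ab ab' aa bb.
have n1 : (1 < n)%N by exact: ltnW.
suff ij : i = j by move: aa bb; rewrite -ij => /(petal_inj n1)-> /(petal_inj n1)->.
have S1 (k : 'I_n) : ordS k <> k.
  by apply/eqP; have := eq_iter_ordS k n1 (ltnW n1) => /= ->.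
have S2 (k : 'I_n) : ordS (ordS k) <> k.
  by apply/eqP; have := eq_iter_ordS k n3 (ltnW n1) => /= ->.
have nab : a <> b by move=> E; move: ab; rewrite E e_irr.
have nab' : a' <> b' by move=> E; move: ab'; rewrite E e_irr.
move/eqP: aa; move/eqP: bb; rewrite !petal_eq //.
(* Unless [i = j], comparing the normal forms of [petal_eq] makes an edge a loop or gives a fixed
   point of [ordS] or of its square. *)
case: (a =P y) => [ay|_]; case: (a' =P y) => [ay'|_];
  case: (b =P y) => [by_|_]; case: (b' =P y) => [by'|_];
  rewrite !xpair_eqE => /andP[/eqP E1 /eqP E2] /andP[/eqP E3 /eqP E4] //;
  try (by apply: ordS_inj);
  try (by case: nab; congruence); try (by case: nab'; congruence);
  by [case: (S1 i); congruence | case: (S1 j); congruence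
     |case: (S2 i); congruence | case: (S2 j); congruence].
Qed.

(** A chain enters its [k]th petal at [s k] and leaves it at [t k]; each exit [y] is glued to the
    next entry [x], so inner terms cancel. *)
Lemma petal_telescope (V : zmodType) (F : flower n x y -> V) (i : 'I_n) m
    (s t : nat -> T) :
  (forall k, (k < m)%N -> t k = y) -> (forall k, (k < m)%N -> s k.+1 = x) ->
  \sum_(k < m.+1) (F (petal x y (iter k (@ordS n) i) (s k))
                   - F (petal x y (iter k (@ordS n) i) (t k)))
  = F (petal x y i (s 0)) - F (petal x y (iter m (@ordS n) i) (t m)).
Proof.
elim: m => [|m IHm] ty sx; first by rewrite big_ord1.
rewrite big_ord_recr IHm => [|k /ltnW /ty //|k /ltnW /sx //] /=.
by rewrite ty // sx // petal_glue addrA addrNK.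
Qed.

Lemma sum_petal_diff (g : 'I_n -> R) (s t : T) (w : flower n x y) :
  \sum_(p : 'I_n * T | petal x y p.1 p.2 == w)
     g p.1 * ((p.2 == s)%:R - (p.2 == t)%:R)
  = \sum_k g k * ((petal x y k s == w)%:R - (petal x y k t == w)%:R).
Proof.
rewrite big_mkcond -(pair_big xpredT xpredT (fun k a =>
  if petal x y k a == w then g k * ((a == s)%:R - (a == t)%:R) else 0)) /=.
apply: eq_bigr => k _; rewrite mulrBr -(sum_delta_diff (fun a => g k * (petal x y k a == w)%:R)).
by apply: eq_bigr => a _; case: ifP; rewrite ?mulr1 // mulr0 mul0r.
Qed.

(** What leaves a petal at [y] enters the next one at [x]: reindexing by [ordS] cancels sources
    against sinks. *)
Lemma sum_petal_circulation (c : R) (w : flower n x y) :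
  \sum_(p : 'I_n * T | petal x y p.1 p.2 == w)
     c * ((p.2 == x)%:R - (p.2 == y)%:R) = 0.
Proof.
rewrite (sum_petal_diff (fun=> c)) -mulr_sumr sumrB.
rewrite (reindex_inj (@ordS_inj n)) /= -sumrB big1 ?mulr0 // => k _.
by rewrite petal_glue subrr.
Qed.

(** By [petal_edge_inj] every edge at [w] comes from exactly one petal edge, at one representative
    of [w]. *)
Lemma lap_flower (e : rel T) (f : flower n x y -> R) w :
  irreflexive e -> (3 <= n)%N ->
  lap (@flower_adj T e n x y) f w =
  \sum_(p : 'I_n * T | petal x y p.1 p.2 == w)
    lap e (fun a => f (petal x y p.1 a)) p.2.
Proof.
move=> e_irr n3; rewrite /lap pair_big_dep /=.
rewrite (partition_big (fun q : 'I_n * T * T => petal x y q.1.1 q.2)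
  (@flower_adj T e n x y w)) /= => [|[[k a] b] /= /andP[kaw ab]]; last first.
  apply/existsP; exists k; apply/existsP; exists a; apply/existsP; exists b.
  by rewrite ab kaw eqxx.
apply: eq_bigr => v /existsP[k /existsP[a /existsP[b /and3P[ab /eqP kaw /eqP kbv]]]].
rewrite (big_pred1 (k, a, b)) /= ?kaw ?kbv // => -[[k' a'] b'] /=.
apply/andP/eqP => [[/andP[/eqP ka' ab'] /eqP kb']|[-> -> ->]]; last first.
  by rewrite kaw kbv ab !eqxx.
by case: (petal_edge_inj e_irr n3 ab' ab (etrans ka' (esym kaw))
  (etrans kb' (esym kbv))) => -> -> ->.
Qed.

Lemma glue_potentials (psi : 'I_n -> T -> R) :
  \sum_k (psi k x - psi k y) = 0 ->
  exists f : flower n x y -> R,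
    forall k a b, f (petal x y k a) - f (petal x y k b) = psi k a - psi k b.
Proof.
(* [S k] is the total drop over the petals before [k]; shifting petal [k] to the value [- S k] at
   [x] matches it with its predecessor. *)
move=> psi0; pose S m := \sum_(j < n | (j < m)%N) (psi j x - psi j y).
pose phi k a := psi k a - psi k x - S k.
have SS (k : 'I_n) : S k.+1 = S k + (psi k x - psi k y).
  rewrite /S (bigD1 k) //= addrC; congr (_ + _); apply: eq_bigl => j.
  by rewrite ltnS -val_eqE /= ltn_neqAle andbC.
have SordS (k : 'I_n) : S (ordS k) = S k.+1.
  rewrite /=; have := ltn_ord k; rewrite leq_eqVlt => /orP[/eqP->|/modn_small-> //].
  (* After the last petal comes petal 0, where [S] is an empty sum; [psi0] closes the cycle. *)
  by rewrite modnn /S big_pred0 // -[LHS]psi0; apply: eq_bigl => j; rewrite ltn_ord.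
have phi_glue k : phi k y = phi (ordS k) x by rewrite /phi SordS SS; ring.
exists (fun u => phi (repr u).1 (repr u).2).
have phiE k a : phi (repr (petal x y k a)).1 (repr (petal x y k a)).2 = phi k a.
  set u := petal x y k a.
  have /eqP : petal x y (repr u).1 (repr u).2 = petal x y k a.
    by rewrite {1}/petal -surjective_pairing reprK.
  rewrite petal_eq //; case: ((repr u).2 =P y) => [->|_]; case: (a =P y) => [->|_];
  by rewrite xpair_eqE ?phi_glue => /andP[/eqP E1 /eqP E2]; rewrite ?E1 ?E2.
by move=> k a b; rewrite !phiE /phi; ring.
Qed.

End Petals.

(** Stated on differences because a glued potential is known in each petal only up to a constant. *)
Lemma lap_linear (R : realFieldType) (T : finType) (e : rel T)
    (f g h : T -> R) (c : R) s :
  (forall p q, f p - f q = g p - g q + c * (h p - h q)) ->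
  lap e f s = lap e g s + c * lap e h s.
Proof.
by move=> fE; rewrite /lap mulr_sumr -big_split; apply: eq_bigr.
Qed.

Lemma lap_sum (R : realFieldType) (T I : finType) (e : rel T)
    (c : I -> R) (h : I -> T -> R) s :
  lap e (fun q => \sum_j c j * h j q) s = \sum_j c j * lap e (h j) s.
Proof.
rewrite /lap; under [RHS]eq_bigr do rewrite mulr_sumr.
rewrite exchange_big /=; apply: eq_bigr => t _.
by rewrite -sumrB; apply: eq_bigr => j _; rewrite mulrBr.
Qed.

(** * Resistance along a chain of petals *)

Section FlowerResistance.
Variables (R : realFieldType) (T : finType) (e : rel T) (n : nat) (x y : T).
Hypotheses (e_sym : symmetric e) (e_irr : irreflexive e).
Hypothesis e_conn : forall s t, connect e s t.
Hypotheses (xy : x != y) (n_ge3 : (3 <= n)%N).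

Local Notation r := (resistance R e).
Local Notation H := (fun q : T => green R e q x - green R e q y).

(** Polarization of the quadratic form [r]; the 2, once squared, yields the 4 in the denominators of
    the theorem. *)
Lemma green_diff a b :
  H a - H b = (r a y + r b x - r a x - r b y) / 2.
Proof.
rewrite !resistance_green // !(green_sym R e_sym y) !(green_sym R e_sym x).
by field.
Qed.

(* A unit current is sent from the start to the end of a chain of m + 1 petals,
   superposed with the circulation around the flower that makes the total
   potential drop along the cycle vanish. *)
Lemma resistance_chain (i : 'I_n) m (s t : nat -> T) :
  (m < n)%N ->
  (forall k, (k < m)%N -> t k = y) -> (forall k, (k < m)%N -> s k.+1 = x) ->
  resistance R (@flower_adj T e n x y)
    (petal x y i (s 0)) (petal x y (iter m (@ordS n) i) (t m))
  = \sum_(k < m.+1) r (s k) (t k)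
    - (\sum_(k < m.+1) (H (s k) - H (t k))) ^+ 2 / (n%:R * r x y).
Proof.
move=> mn ty sx; set D := \sum_(k < m.+1) (H _ - H _).
have r0 : r x y != 0 by exact: resistance_neq0.
have n0 : n%:R != 0 :> R by rewrite pnatr_eq0 -lt0n; apply: leq_trans n_ge3.
pose c := - D / (n%:R * r x y).
pose h (j : 'I_m.+1) q := green R e q (s j) - green R e q (t j).
(* [d] places the unit flow [h j] in the [j]th petal of the chain, so [psi] vanishes on petals off
   the chain. *)
pose d k (j : 'I_m.+1) : R := (k == iter j (@ordS n) i)%:R.
pose psi k q := \sum_j d k j * h j q.
have psi_drop : \sum_k (psi k x - psi k y) = D.
  under eq_bigr do rewrite -sumrB; rewrite exchange_big; apply: eq_bigr => j _ /=.
  rewrite (bigD1 (iter j (@ordS n) i)) //= big1 => [|k /negPf ki]; last first.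
    by rewrite /d ki !mul0r subrr.
  (* Reciprocity: symmetry of [green] turns the drop of [h j] from [x] to [y] into that of [H] from
     [s j] to [t j]. *)
  rewrite /d eqxx !mul1r /h !(green_sym R e_sym x) !(green_sym R e_sym y); ring.
have [|f fE] := @glue_potentials R T n x y xy (fun k q => psi k q + c * H q).
  under eq_bigr => k _.
    rewrite (_ : _ - _ = (psi k x - psi k y) + c * (H x - H y)); last by ring.
    over.
  rewrite big_split /= psi_drop sumr_const card_ord -mulr_natl.
  have -> : H x - H y = r x y by rewrite resistance_green //; ring.
  by rewrite /c; field; rewrite n0 r0.
have fE' k p q : f (petal x y k p) - f (petal x y k q)
    = psi k p - psi k q + c * (H p - H q) by rewrite fE; ring.
rewrite (@resistance_potential _ _ _ _ _ f).
- rewrite -(petal_telescope f i ty sx) /c.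
  rewrite (_ : _ / _ = - c * D); last by rewrite /c; ring.
  rewrite mulNr opprK /D mulr_sumr -big_split; apply: eq_bigr => j _ /=.
  rewrite fE'; congr (_ + _); rewrite resistance_green //.
  have psiE q : psi (iter j (@ordS n) i) q = h j q.
    rewrite /psi (bigD1 j) //= /d eqxx mul1r big1 ?addr0 // => l lj.
    (* Since [m < n], the petals of the chain are distinct and only the term [j] survives. *)
    rewrite eq_iter_ordS ?(leq_trans (ltn_ord _)) // eq_sym.
    by rewrite val_eqE (negPf lj) mul0r.
  by rewrite !psiE.
- exact: flower_adj_sym.
- by apply: flower_adj_irr => //; exact: ltnW.
- move=> w; rewrite lap_flower //.
  under eq_bigr do rewrite (lap_linear e _ (fE' _)) lap_green //.
  rewrite big_split /= sum_petal_circulation addr0.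
  under eq_bigr do rewrite lap_sum.
  (* The required source and sink at [w] telescope too: they are the sum of those of the petals in
     the chain. *)
  rewrite exchange_big /= -(petal_telescope (fun u => (w == u)%:R) i ty sx).
  apply: eq_bigr => j _; under eq_bigr do rewrite lap_green //.
  rewrite (sum_petal_diff (fun k => d k j)).
  rewrite (bigD1 (iter j (@ordS n) i)) //= big1 => [|k /negPf ki]; last first.
    by rewrite /d ki mul0r.
  by rewrite /d eqxx mul1r addr0 !(eq_sym w).
Qed.

End FlowerResistance.

Theorem theorem3p2 (R : realFieldType) (T : finType) (e : rel T)
  (e_sym : symmetric e) (e_irr : irreflexive e)
  (e_conn : forall s t : T, connect e s t)
  (x y : T) (xy : x != y) (n : nat) (n_ge3 : (3 <= n)%N)
  (u v : flower n x y) (a b : T) :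
  let r := resistance R e in
  let rF := resistance R (@flower_adj T e n x y) in
  (forall (i : 'I_n) (d : nat), (2 <= d <= n)%N ->
     u = petal x y i a -> v = petal x y (iter d.-1 (@ordS n) i) b ->
     rF u v = r a y + r b x + (d%:R - 2) * r x y
              - (r a x + r b y - r a y - r b x - 2 * (d%:R - 1) * r x y) ^+ 2
                / (4 * n%:R * r x y)) /\
  (forall i : 'I_n, u = petal x y i a -> v = petal x y i b ->
     rF u v = r a b
              - (r a x + r b y - r a y - r b x) ^+ 2 / (4 * n%:R * r x y)).
Proof.
move=> r rF; have r0 : r x y != 0 by exact: resistance_neq0.
have n0 : n%:R != 0 :> R by rewrite pnatr_eq0 -lt0n; apply: leq_trans n_ge3.
have rr p : r p p = 0 by rewrite /r resistance_green // subrr.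
have rC p q : r p q = r q p by rewrite /r !resistance_green // (green_sym R e_sym p); ring.
split=> [i [|[|m]] // /andP[_ mn] -> ->|i -> ->].
  (* Here [d = m + 2]: the entries are [a, x, ..., x] and the exits [y, ..., y, b]. *)
  pose s k := if k == 0%N then a else x.
  pose t k := if k == m.+1 then b else y.
  have ty k : (k < m.+1)%N -> t k = y by rewrite /t; case: ltngtP.
  have := @resistance_chain R T e n x y e_sym e_irr e_conn xy n_ge3 i m.+1 s t mn ty
    (fun _ _ => erefl).
  have -> : t m.+1 = b by rewrite /t eqxx.
  rewrite -[s 0%N]/a -/r -/rF => ->.
  have sum_chain (F : T -> T -> R) :
      \sum_(k < m.+2) F (s k) (t k) = F a y + m%:R * F x y + F x b.
    rewrite big_ord_recl big_ord_recr /= /t /= /bump /= add1n eqxx addrA.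
    congr (_ + _ + _); rewrite mulr_natl -[m in RHS]card_ord -sumr_const.
    by apply: eq_bigr => k _; rewrite add1n eqSS ltn_eqF.
  rewrite (sum_chain r) (sum_chain (fun p q => green R e p x - green R e p y
    - (green R e q x - green R e q y))).
  (* The drop along the chain becomes minus half the bracket of the statement. *)
  rewrite !green_diff // -/r !rr (rC x b) (rC y x) -!natr1.
  by field; rewrite r0 n0.
(* One petal is a chain with [m = 0], whose gluing conditions are vacuous. *)
have := @resistance_chain R T e n x y e_sym e_irr e_conn xy n_ge3 i 0 (fun=> a) (fun=> b).
rewrite !big_ord1 /= -/r -/rF => -> //; last by exact: leq_trans n_ge3.
by rewrite green_diff // -/r; field; rewrite r0 n0.
Qed.
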